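(* Let $\mathbb{K}$ be a field and let $G$ be a finite simple graph. Then for every integer $k\geq 1$, $${\rm reg}(J(G)^{(k)})\leq (k-1)\gamma(G)+\max\big\{{\rm reg}(J(H))\mid H \text{ is a subgraph of } G\big\}.$$
   Context: For a finite simple graph $G$ with $V(G)=\{x_1,\ldots,x_n\}$, let $S=\mathbb{K}[x_1,\ldots,x_n]$. The cover ideal is $J(G)=\bigcap_{x_ix_j\in E(G)}(x_i,x_j)$ and its $k$-th symbolic power is $J(G)^{(k)}=\bigcap_{x_ix_j\in E(G)}(x_i,x_j)^k$ (both equal $S$ if $G$ has no edges). The regularity of a graded module $M$ is ${\rm reg}(M)=\max\{j-i\mid \beta_{i,j}(M)\neq 0\}$; regularities are of ideals viewed as modules. Subgraphs $H$ are arbitrary (not necessarily induced). For a set $A$ of vertices, $N_G(A)=\bigcup_{x\in A}N_G(x)$ and $N_G[A]=N_G(A)\cup A$; $G\setminus B$ denotes the graph obtained by deleting the vertices in $B$. Define $$\gamma(G)=\max\Big\{\tfrac{|V(G)|+|N_G(A)|-|A|}{2}\;\Big|\; A \text{ is a (possibly empty) independent set of } G \text{ and } G\setminus N_G[A] \text{ has no bipartite connected component}\Big\},$$ where an isolated vertex counts as a bipartite connected component and the graph with no vertices has no connected components. *)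

(* Defs.v *)
From HB Require Import structures.
From mathcomp Require Export all_boot all_order all_algebra.
From mathcomp Require Export mpoly.
Set Implicit Arguments.
Unset Strict Implicit.
Unset Printing Implicit Defensive.
Import Order.TTheory GRing.Theory Num.Theory.
Local Open Scope ring_scope.

(** * Ideals of K[x_0, ..., x_(n-1)], as predicates *)

Section Ideals.
Variables (K : fieldType) (n : nat).
Local Notation S := {mpoly K[n]}.

Definition ideal_gen (P : S -> Prop) : S -> Prop := fun f =>
  exists (m : nat) (c g : 'I_m -> S),
    (forall i, P (g i)) /\ f = \sum_(i < m) c i * g i.

Definition ideal_mul (I J : S -> Prop) : S -> Prop :=
  ideal_gen (fun h => exists f g, [/\ I f, J g & h = f * g]).

Fixpoint ideal_pow (I : S -> Prop) (k : nat) : S -> Prop :=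
  if k is k'.+1 then ideal_mul I (ideal_pow I k') else fun _ => True.

Definition edge_ideal (i j : 'I_n) : S -> Prop :=
  ideal_gen (fun f => f = 'X_i \/ f = 'X_j).

(* A graph on the vertices x_0, ..., x_(n-1) is its adjacency relation; both
   intersections are the whole ring when there is no edge. *)
Definition cover_ideal (G : rel 'I_n) : S -> Prop := fun f =>
  forall i j, G i j -> edge_ideal i j f.

Definition symbolic_power_cover_ideal (G : rel 'I_n) (k : nat) : S -> Prop :=
  fun f => forall i j, G i j -> ideal_pow (edge_ideal i j) k f.

End Ideals.

Arguments cover_ideal K {n} G.
Arguments symbolic_power_cover_ideal K {n} G k.

(** * Graded Betti numbers and regularity *)

Section Regularity.
Variables (K : fieldType) (n : nat).
Local Notation S := {mpoly K[n]}.

(* p lies in the graded component S_d; S_d = 0 for d < 0. *)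
Definition in_degree (d : int) (p : S) : Prop :=
  p != 0 -> exists2 e : nat, d = e%:Z & p \is e.-homog.

(* The data of  ... -> F_2 -> F_1 -> F_0 -> S  with F_i the graded free module
   \bigoplus_a S(- shift i a), whose elements are row vectors, the maps acting
   by multiplication on the right. *)
Record free_complex := FreeComplex {
  rank : nat -> nat;
  shift : forall i, 'I_(rank i) -> int;
  diff : forall i, 'M[S]_(rank i.+1, rank i);
  aug : 'cV[S]_(rank 0) }.

(* F is a minimal graded free resolution  ... -> F_1 -> F_0 -> I -> 0  of the
   homogeneous ideal I: maps of degree 0, exactness, and F_(i+1) mapped into
   (x_0, ..., x_(n-1)) F_i, i.e. entries without constant term. *)
Record minimal_free_resolution (I : S -> Prop) (F : free_complex) : Prop :=
  MinimalFreeResolution {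
  aug_graded : forall a, in_degree (shift a) (aug F a 0);
  diff_graded : forall i a b, in_degree (shift a - shift b) (diff F i a b);
  aug_image : forall f : S, I f <-> exists v : 'rV_(rank F 0), v *m aug F = f%:M;
  exact_aug : forall v : 'rV_(rank F 0),
    v *m aug F = 0 <-> exists w : 'rV_(rank F 1), v = w *m diff F 0;
  exact_diff : forall i (v : 'rV_(rank F i.+1)),
    v *m diff F i = 0 <-> exists w : 'rV_(rank F i.+2), v = w *m diff F i.+1;
  minimal : forall i a b, (diff F i a b)@_0%MM = 0 }.

Definition betti (F : free_complex) (i : nat) (j : int) : nat :=
  #|[set a : 'I_(rank F i) | shift a == j]|.

(* reg I = r, i.e. r = max {j - i | beta_(i,j)(I) != 0}. It is a relation as
   the Betti numbers are read off a minimal resolution, which is unique up to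
   isomorphism. *)
Definition is_regularity (I : S -> Prop) (r : int) : Prop :=
  exists F : free_complex,
    [/\ minimal_free_resolution I F,
        exists i j, betti F i j <> 0%N /\ r = j - i%:Z
      & forall i j, betti F i j <> 0%N -> j - i%:Z <= r].

End Regularity.

(** * Graphs *)

Section Graphs.
Variables (n : nat) (G : rel 'I_n).
Implicit Types A B C U : {set 'I_n}.

Definition independent A : bool := [forall x in A, forall y in A, ~~ G x y].

Definition nbr A : {set 'I_n} := [set y | [exists x in A, G x y]].

Definition closed_nbr A : {set 'I_n} := nbr A :|: A.

(* The connected component of x in the subgraph induced on U, for x in U. *)
Definition component U (x : 'I_n) : {set 'I_n} :=
  [set y | connect [rel u v | [&& u \in U, v \in U & G u v]] x y].

Definition bipartite_on C : bool :=
  [exists B : {set 'I_n}, forall x in C, forall y in C,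
     G x y ==> ((x \in B) != (y \in B))].

Definition no_bipartite_component U : bool :=
  [forall x in U, ~~ bipartite_on (component U x)].

(* The default value 0 is harmless: maximal independent sets are admissible,
   and all the values are nonnegative. *)
Definition gamma : rat :=
  \big[Num.max/0]_(A : {set 'I_n} |
      independent A && no_bipartite_component (~: closed_nbr A))
    ((n%:R + #|nbr A|%:R - #|A|%:R) / 2%:R).

(* A subgraph H is a pair of a vertex set H.1 and a symmetric set H.2 of
   adjacent ordered pairs of elements of H.1. *)
Definition is_subgraph (H : {set 'I_n} * {set 'I_n * 'I_n}) : bool :=
  [forall e in H.2,
     [&& (e.2, e.1) \in H.2, e.1 \in H.1, e.2 \in H.1 & G e.1 e.2]].

End Graphs.

(* H as a graph on 'I_#|H.1|, so that J(H) is an ideal of the polynomial ring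
   on the vertices of H. *)
Definition subgraph_rel (n : nat) (H : {set 'I_n} * {set 'I_n * 'I_n}) :
  rel 'I_#|H.1| := fun a b => (enum_val a, enum_val b) \in H.2.

Arguments subgraph_rel {n} H.

(* Main.v *)
From Stdlib Require Import Classical_Prop.
From mathcomp Require Import ring lra zify.
Require Import Defs.
Set Implicit Arguments.
Unset Strict Implicit.
Unset Printing Implicit Defensive.
Import Order.TTheory GRing.Theory Num.Theory.
Local Open Scope ring_scope.

(** The Betti number beta_(i,j) of a monomial ideal I is the sum, over the
    multidegrees a with |a| = j, of the dimensions of the reduced homology in
    dimension i - 1 of the upper Koszul complex of I at a, whose faces are the
    sets T of variables such that x^(a - T) is a monomial of I.  So it suffices
    to bound |a| - i whenever the complex of J(G)^(k) at a has homology in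
    dimension i - 1.

    Its faces are the T contained in the support of a with
      a_u - [u in T] + a_v - [v in T] >= k  for every edge uv.
    Choose a subset C of the support of a, maximal among those containing no
    edge uv with a_u + a_v = k, and put b = a - 1_C.  Then b_u + b_v >= k - 1 on
    every edge.  Let H be the subgraph of G formed by the edges where
    equality holds.  The complex of J(G)^(k) at a is equal to the complex of
    J(H) at the squarefree multidegree 1_C, because the other edges impose no
    condition on a subset of C; hence |C| - i <= reg J(H).  It remains to see
    that |b| <= (k - 1) gamma(G).  A vertex v that is in no edge of H and
    satisfies b_v > 0 would make the complex a cone, so that every v with
    b_v > 0 lies on an edge where b sums to k - 1 ([squarefree_reduction]).

    Write m = k - 1.  For 0 < t <= m let A_t be the set of vertices with
    2 b_v < t.  It is independent, and tightness gives
    N(A_t) = {v | 2 b_v > 2m - t}, whence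
      2 |b| = sum over t = 1, ..., m of (n + |N(A_t)| - |A_t|).
    The graph G without N[A_t] has no isolated vertex, so that adding to A_t
    the smaller sides of its bipartite components yields a set that is
    admissible in the definition of gamma and does not decrease |N(A)| - |A|.
    Hence each summand is at most 2 gamma(G) ([sum_le_gamma]).

    The formula for Betti numbers ([betti_eq0P]) is proved for vanishing only,
    which is all that the argument uses.  Let B_i be the image of the i-th map
    of the resolution, counting the augmentation as map 0.  Since the Koszul
    complex of a free module is exact in positive degrees, Koszul homology of
    B_i in degree p + 1 vanishes together with that of B_(i+1) in degree p
    ([image_exact_shift]), and in degree 0 it is read off the basis by
    minimality ([image_exact0]).  On the other hand, the Koszul complex of a
    monomial ideal splits by multidegree into the chain complexes of the upper
    Koszul complexes ([koszul_boundary], [image_exact_acyclic]). *)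

(** * The Koszul differential *)

Section KoszulDifferential.
Variables (R : comNzRingType) (n : nat) (x : 'I_n -> R).
Implicit Types (T : {set 'I_n}) (c : {set 'I_n} -> R) (v w : 'I_n).

Definition ksign v T : R := (-1) ^+ #|[set u in T | (u < v)%N]|.

(** A function [c] of subsets stands for the element of the exterior algebra
    whose coefficient on the basis vector indexed by [T] is [c T].  With the
    variables as weights this is the Koszul complex of the polynomial ring; with
    all the weights equal to 1 it is the augmented chain complex of a
    simplex, a face with p vertices lying in degree p. *)
Definition kdiff c T : R := \sum_(v | v \notin T) ksign v T * x v * c (v |: T).

Lemma ksign_sqr v T : ksign v T * ksign v T = 1.
Proof. by rewrite /ksign -expr2 sqrr_sign. Qed.

Lemma ksignU1 v w T : w \notin T ->
  ksign v (w |: T) = (-1) ^+ (w < v)%N * ksign v T.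
Proof.
move=> wT; rewrite /ksign -exprD; congr (_ ^+ _).
case: (ltnP w v) => wv.
  rewrite -[LHS](_ : #|w |: [set u in T | (u < v)%N]| = _).
    by rewrite cardsU1 inE (negPf wT).
  by apply: eq_card => u; rewrite !inE; case: eqP => [->|].
apply: eq_card => u; rewrite !inE; case: eqP => [->|] //=.
by rewrite ltnNge wv andbF.
Qed.

Lemma ksign_swap v w T : v != w -> v \notin T -> w \notin T ->
  ksign v T * ksign w (v |: T) = - (ksign w T * ksign v (w |: T)).
Proof.
move=> vw vT wT; rewrite !ksignU1 //.
have -> : (w < v)%N = ~~ (v < w)%N.
  by move: vw; rewrite -val_eqE /=; case: ltngtP.
by case: (v < w)%N; rewrite /= ?expr1 ?expr0; ring.
Qed.

Lemma eq_kdiff c c' T : c =1 c' -> kdiff c T = kdiff c' T.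
Proof. by move=> cc'; apply: eq_bigr => v _; rewrite cc'. Qed.

Lemma kdiffB c c' T :
  kdiff (fun T' => c T' - c' T') T = kdiff c T - kdiff c' T.
Proof. by rewrite -sumrB; apply: eq_bigr => v _; rewrite mulrBr. Qed.

Lemma kdiff_sumr (I : finType) (c : I -> {set 'I_n} -> R) (e : I -> R) T :
  kdiff (fun T' => \sum_i c i T' * e i) T = \sum_i kdiff (c i) T * e i.
Proof.
rewrite /kdiff (eq_bigr (fun v =>
  \sum_i ksign v T * x v * c i (v |: T) * e i)); last first.
  by move=> v _; rewrite mulr_sumr; apply: eq_bigr => i _; rewrite mulrA.
by rewrite exchange_big; apply: eq_bigr => i _; rewrite mulr_suml.
Qed.

(** The terms for (v, w) and (w, v) cancel; they are matched by splitting the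
    double sum along v < w and w < v, which works in characteristic 2 too. *)
Lemma kdiff_kdiff c T : kdiff (kdiff c) T = 0.
Proof.
pose t v w := ksign v T * x v * (ksign w (v |: T) * x w * c (w |: (v |: T))).
have tC v w : v != w -> v \notin T -> w \notin T -> t v w = - t w v.
  move=> vw vT wT; rewrite /t setUCA -2!mulrA.
  rewrite [LHS](_ : _ = ksign v T * ksign w (v |: T)
                         * (x v * x w * c (v |: (w |: T)))); last by ring.
  by rewrite (ksign_swap vw vT wT); ring.
pose P v w := [&& v \notin T, w \notin T & (v < w)%N].
have -> : kdiff (kdiff c) T =
    \sum_v \sum_(w | P v w) t v w + \sum_v \sum_(w | P w v) t v w.
  rewrite -big_split /= /kdiff big_mkcond; apply: eq_bigr => v _.
  case: ifPn => vT; last first.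
    by rewrite !big_pred0 ?addr0 // => w; rewrite /P (negPf vT) ?andbF.
  rewrite mulr_sumr (bigID (fun w => (v < w)%N)) /=; congr (_ + _).
    apply: eq_bigl => w; rewrite /P !inE negb_or vT /= -andbA.
    by rewrite -val_eqE /=; case: ltngtP; rewrite ?andbF ?andbT.
  apply: eq_bigl => w; rewrite /P !inE negb_or vT /= -val_eqE /=.
  by case: ltngtP; rewrite ?andbF ?andbT.
rewrite [X in _ + X](exchange_big_dep xpredT) //= -big_split big1 // => v _.
rewrite /= -big_split big1 // => w /and3P[vT wT vw] /=.
by rewrite (tC v w) ?addNr // -val_eqE neq_ltn vw.
Qed.

Definition kcone v c T : R := if v \in T then ksign v (T :\ v) * c (T :\ v) else 0.

(** A vertex of weight 1 makes coning off with it a contracting homotopy. *)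
Lemma kdiff_kcone v c T : x v = 1 ->
  kdiff (kcone v c) T + kcone v (kdiff c) T = c T.
Proof.
move=> xv; rewrite {2}/kcone; case: ifPn => vT.
  have [T0 vT0 ->] : exists2 T0 : {set _}, v \notin T0 & T = v |: T0.
    by exists (T :\ v); rewrite ?setD1K // !inE eqxx.
  rewrite setU1K // {2}/kdiff (bigD1 v) //= mulrDr addrCA !mulrA.
  rewrite ksign_sqr xv !mul1r.
  rewrite [X in _ + X](_ : _ = 0) ?addr0 // mulr_sumr.
  rewrite (eq_bigl (fun w => w \notin v |: T0)); last first.
    by move=> w; rewrite !inE negb_or andbC.
  rewrite -big_split big1 //= => w; rewrite !inE negb_or => /andP[wv wT0].
  rewrite /kcone !inE eqxx orbT setUCA setU1K; last first.
    by rewrite !inE negb_or eq_sym wv.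
  rewrite [X in X + _](_ : _ = ksign w (v |: T0) * ksign v (w |: T0)
      * (x w * c (w |: T0))); last by ring.
  rewrite !ksignU1 //.
  have -> : (w < v)%N = ~~ (v < w)%N.
    by move: wv; rewrite -val_eqE /=; case: ltngtP.
  by case: (v < w)%N; rewrite /= ?expr1 ?expr0; ring.
rewrite addr0 /kdiff (bigD1 v) //= big1 => [|w /andP[wT wv]].
  by rewrite /kcone setU11 setU1K // xv addr0 mulr1 mulrA ksign_sqr mul1r.
by rewrite /kcone !inE eq_sym (negPf wv) (negPf vT) mulr0.
Qed.

End KoszulDifferential.

(** * Koszul homology of monomial ideals *)

Definition chain_in (R : nzRingType) (n : nat) (D : pred {set 'I_n}) (p : nat)
    (u : {set 'I_n} -> R) : Prop :=
  forall T, u T != 0 -> D T && (#|T| == p).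

(** Vanishing of the homology, with coefficients in [K], of the family of sets
    [D] at the sets of cardinality [p]; for a simplicial complex this is the
    reduced homology in dimension [p - 1]. *)
Definition acyclic (K : fieldType) (n : nat) (D : pred {set 'I_n}) (p : nat) :
    Prop :=
  forall u : {set 'I_n} -> K, chain_in D p u ->
  (forall T, kdiff (fun=> 1) u T = 0) ->
  exists2 w, chain_in D p.+1 w & forall T, kdiff (fun=> 1) w T = u T.

Lemma acyclic_cone (K : fieldType) n (D : pred {set 'I_n}) p v :
  (forall T, D (v |: T) = D T) -> acyclic K D p.
Proof.
move=> Dv u uD du0; exists (kcone v u) => [T|T]; last first.
  rewrite -[RHS](@kdiff_kcone _ _ (fun=> 1) v) // {3}/kcone du0 mulr0.
  by case: ifP; rewrite addr0.
rewrite /kcone; case: ifPn => [vT|_]; last by rewrite eqxx.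
have [->|/uD/andP[DT /eqP cT] _] := eqVneq (u (T :\ v)) 0.
  by rewrite mulr0 eqxx.
by rewrite -{1}(setD1K vT) Dv DT -cT (cardsD1 v T) vT add1n eqxx.
Qed.

Lemma eq_acyclic (K : fieldType) n (D D' : pred {set 'I_n}) p :
  D =1 D' -> acyclic K D p -> acyclic K D' p.
Proof.
move=> DD' acD u uD' du0.
have [|//|w wD dw] := acD u; first by move=> T /uD'; rewrite DD'.
by exists w => // T /wD; rewrite DD'.
Qed.

Section Monomials.
Variables (K : fieldType) (n : nat).
Local Notation S := {mpoly K[n]}.
Implicit Types (T : {set 'I_n}) (a m : 'X_{1..n}) (z w : {set 'I_n} -> S).

Definition mset T : 'X_{1..n} := [multinom nat_of_bool (v \in T) | v < n].

(** The upper Koszul complex, in multidegree [a], of the ideal spanned by the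
    monomials satisfying [M]. *)
Definition face (M : pred 'X_{1..n}) a : pred {set 'I_n} :=
  fun T => (mset T <= a)%MM && M (a - mset T)%MM.

(** The part of multidegree [a] of a Koszul chain, as a scalar chain. *)
Definition multipart a z T : K :=
  if (mset T <= a)%MM then (z T)@_(a - mset T) else 0.

Local Notation X := (fun v : 'I_n => 'X_v : S).

Lemma mset0 : mset set0 = 0%MM.
Proof. by apply/mnmP => v; rewrite mnmE inE mnm0E. Qed.

Lemma msetU1 v T : v \notin T -> mset (v |: T) = (U_(v) + mset T)%MM.
Proof.
move=> vT; apply/mnmP => u; rewrite mnmDE mnm1E !mnmE !inE eq_sym.
by case: eqP => [<-|]; rewrite ?(negPf vT).
Qed.

Lemma mset_leP T a : reflect (forall v, v \in T -> (0 < a v)%N) (mset T <= a)%MM.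
Proof.
apply: (iffP mnm_lepP) => leTa v.
  by move=> vT; have := leTa v; rewrite mnmE vT.
by rewrite mnmE; case: (boolP (v \in T)) => // /leTa.
Qed.

Lemma mdeg_mset T : mdeg (mset T) = #|T|.
Proof.
rewrite mdegE -sum1_card [RHS]big_mkcond.
by apply: eq_bigr => v _; rewrite mnmE; case: ifP.
Qed.

Lemma multipartE m z T : multipart (m + mset T) z T = (z T)@_m.
Proof. by rewrite /multipart lem_addl addmK. Qed.

Lemma multipart_inj z w T :
  (forall a, multipart a z T = multipart a w T) -> z T = w T.
Proof. by move=> zw; apply/mpolyP => m; rewrite -!multipartE zw. Qed.

Lemma mcoeff_signM k (q : S) m : ((-1) ^+ k * q)@_m = (-1) ^+ k * q@_m.
Proof.
rewrite -signr_odd -[in RHS]signr_odd.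
by case: odd; rewrite ?expr0 ?expr1 ?mul1r // !mulN1r mcoeffN.
Qed.

Lemma mcoeffXM v (q : S) m :
  ('X_v * q)@_m = if (0 < m v)%N then q@_(m - U_(v)) else 0.
Proof.
rewrite mulrC; case: ifPn => mv.
  have leUm : (U_(v) <= m)%MM.
    by apply/mnm_lepP => u; rewrite mnm1E; case: eqP => // <-.
  by rewrite -{1}(submK leUm) addmC mcoeffMX.
apply/eqP; rewrite mcoeff_eq0; apply/negP.
rewrite (perm_mem (msuppMX q U_(v))) => /mapP[m' _ defm]; move: mv.
by rewrite defm mnmDE mnm1E eqxx.
Qed.

Lemma multipart_kdiff a z T :
  multipart a (kdiff X z) T = kdiff (fun=> 1) (multipart a z) T.
Proof.
rewrite /kdiff {1}/multipart; case: ifPn => leTa; last first.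
  rewrite big1 // => v vT; rewrite /multipart ifN ?mulr0 //.
  apply: contra leTa => /mset_leP leTa; apply/mset_leP => u uT.
  by apply: leTa; rewrite !inE uT orbT.
rewrite raddf_sum; apply: eq_bigr => v vT.
rewrite /= /ksign -mulrA mcoeff_signM mulr1 mcoeffXM; congr (_ * _).
rewrite /multipart msetU1 // mnmBE mnmE (negPf vT) subn0.
have -> : (U_(v) + mset T <= a)%MM = (0 < a v)%N.
  rewrite -msetU1 //; apply/mset_leP/idP => [-> //|av u]; first by rewrite setU11.
  by rewrite !inE => /orP[/eqP-> //|]; move/mset_leP: leTa; apply.
case: ifP => // _; congr (_ @_ _); apply/mnmP => u.
by rewrite !mnmBE mnmDE addnC subnDA.
Qed.

Lemma chain_multipart (M : pred 'X_{1..n}) p a z :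
  (forall T m, (z T)@_m != 0 -> M m) -> chain_in predT p z ->
  chain_in (face M a) p (multipart a z).
Proof.
move=> zM zp T; rewrite /multipart /face.
case: ifP => [leTa zT|]; last by rewrite eqxx.
rewrite (zM _ _ zT); apply: (zp T); apply: contraNneq zT => ->.
by rewrite mcoeff0.
Qed.

(** Boundaries can be found one multidegree at a time, since only finitely many
    multidegrees occur in a given chain. *)
Lemma koszul_boundary (M : pred 'X_{1..n}) p z :
  (forall a, exists2 w : {set 'I_n} -> K, chain_in (face M a) p.+1 w &
     forall T, kdiff (fun=> 1) w T = multipart a z T) ->
  exists w, [/\ forall T m, (w T)@_m != 0 -> M m, chain_in predT p.+1 w
              & forall T, kdiff X w T = z T].
Proof.
(* Past this bound on the total degree every component of [z] vanishes. *)
move=> bdz; pose N := ((\max_T msize (z T)) + n)%N.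
have /fin_all_exists[w wP] (a : 'X_{1..n < N}) :
    exists w : {set 'I_n} -> K, chain_in (face M a) p.+1 w /\
      forall T, kdiff (fun=> 1) w T = multipart a z T.
  by have [w] := bdz a; exists w.
pose W T : S :=
  \sum_(a : 'X_{1..n < N} | (mset T <= a)%MM) w a T *: 'X_[a - mset T].
have partW (a : 'X_{1..n < N}) T : multipart a W T = w a T.
  rewrite /multipart; case: ifPn => leTa; last first.
    apply/esym/eqP; apply: contraNT leTa => /(proj1 (wP a)).
    by case/andP => /andP[].
  rewrite /W raddf_sum (bigD1 a) //= mcoeffZ mcoeffX eqxx mulr1.
  rewrite big1 ?addr0 // => b /andP[leTb ba]; rewrite mcoeffZ mcoeffX.
  case: eqP => [eqab|_]; last by rewrite mulr0.
  by case/eqP: ba; apply: val_inj; rewrite /= -(submK leTb) eqab submK.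
have partW0 a T : (N <= mdeg a)%N -> multipart a W T = 0.
  move=> leNa; rewrite /multipart; case: ifPn => // leTa.
  rewrite /W raddf_sum big1 // => b leTb; rewrite /= mcoeffZ mcoeffX.
  case: eqP => [eqab|_]; last by rewrite mulr0.
  by have := bmdeg b; rewrite -(submK leTb) eqab submK // ltnNge leNa.
have Wnz T m : (W T)@_m != 0 ->
    exists2 a : 'X_{1..n < N}, w a T != 0 & (a = m + mset T :> 'X_{1..n})%MM.
  rewrite -multipartE; have [/partW0->|ltN] := leqP N (mdeg (m + mset T)%MM).
    by rewrite eqxx.
  by rewrite (partW (BMultinom ltN)) => ?; exists (BMultinom ltN).
exists W; split=> [T m /Wnz[a waT defa]|T WT|T].
- by have /andP[/andP[_]] := proj1 (wP a) _ waT; rewrite defa addmK.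
- have [m] : exists m, (W T)@_m != 0.
    by exists (mlead (W T)); rewrite mleadc_eq0.
  by case/Wnz => a waT _; have /andP[] := proj1 (wP a) _ waT.
apply: multipart_inj => a; rewrite multipart_kdiff.
have [leNa|ltaN] := leqP N (mdeg a).
  rewrite /kdiff big1 => [|v _]; last by rewrite partW0 // mulr0.
  rewrite /multipart; case: ifPn => // leTa; apply/esym/eqP.
  rewrite mcoeff_eq0; apply/negP => /msize_mdeg_lt.
  have le_max : (msize (z T) <= \max_T' msize (z T'))%N by exact: leq_bigmax.
  move/leq_trans/(_ le_max); rewrite ltnNge -(leq_add2r n) (leq_trans leNa) //.
  rewrite -{1}(submK leTa) mdegD leq_add2l mdeg_mset.
  by rewrite (leq_trans (max_card _)) ?card_ord.
rewrite (eq_kdiff _ _ (partW (BMultinom ltaN))).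
exact: (proj2 (wP (BMultinom ltaN))).
Qed.

(** In a nonzero multidegree the Koszul complex of the whole ring is the chain
    complex of a full simplex. *)
Lemma koszul_exact p z : chain_in predT p z ->
  (forall T, kdiff X z T = 0) -> (z set0)@_0 = 0 ->
  exists2 w, chain_in predT p.+1 w & forall T, kdiff X w T = z T.
Proof.
move=> zp dz0 z00.
have [a|w [_ wp dw]] := @koszul_boundary predT p z; last by exists w.
have [->|[v av]] : a = 0%MM \/ exists v, (0 < a v)%N.
  case: (pickP (fun v => 0 < a v)%N) => [v av|a0]; [by right; exists v | left].
  by apply/mnmP => v; rewrite mnm0E; apply/eqP; rewrite -leqn0 leqNgt a0.
- exists (fun=> 0) => [T|T]; first by rewrite eqxx.
  rewrite /kdiff big1 => [|v _]; last by rewrite mulr0.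
  have [->|/set0Pn[v vT]] := eqVneq T set0.
    by rewrite /multipart mset0 lepm_refl subm0 z00.
  rewrite /multipart ifN //; apply/negP => /mset_leP/(_ v vT).
  by rewrite mnm0E.
apply: (@acyclic_cone _ _ _ _ v) => [T||T].
- rewrite /face !andbT; apply/mset_leP/mset_leP => leTa u uT.
    by apply: leTa; rewrite !inE uT orbT.
  by move: uT; rewrite !inE => /orP[/eqP->|/leTa].
- exact: chain_multipart.
by rewrite -multipart_kdiff /multipart dz0 mcoeff0 if_same.
Qed.

End Monomials.

(** * Homogeneous components *)

Section GradedChains.
Variables (K : fieldType) (n : nat).
Local Notation S := {mpoly K[n]}.
Local Notation X := (fun v : 'I_n => 'X_v : S).
Implicit Types (d e j : int) (f g : S) (T : {set 'I_n}).

Definition in_deg d f : Prop := forall m, f@_m != 0 -> (mdeg m)%:Z = d.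

Definition hcomp d f : S :=
  \sum_(m <- msupp f | (mdeg m)%:Z == d) f@_m *: 'X_[m].

Lemma mcoeff_hcomp d f m : (hcomp d f)@_m = if (mdeg m)%:Z == d then f@_m else 0.
Proof.
rewrite raddf_sum /=.
rewrite (eq_bigr (fun k => if k == m then f@_m else 0)); last first.
  by move=> k _; rewrite mcoeffZ mcoeffX; case: eqP => [->|]; rewrite ?mulr1 ?mulr0.
rewrite -big_mkcondr /= big_mkcond /=.
case: (boolP (m \in msupp f)) => [mp|].
  rewrite (bigD1_seq m) ?msupp_uniq //= eqxx andbT big1 ?addr0 // => k /negPf->.
  by rewrite andbF.
by rewrite mcoeff_msupp negbK => /eqP->; rewrite big1 => [|k _]; case: ifP.
Qed.

Lemma in_deg_hcomp d f : in_deg d (hcomp d f).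
Proof.
by move=> m; rewrite mcoeff_hcomp; case: ifP => [/eqP|_] //; rewrite eqxx.
Qed.

Lemma hcomp_id d f : in_deg d f -> hcomp d f = f.
Proof.
move=> pd; apply/mpolyP => m; rewrite mcoeff_hcomp; case: eqP => // md.
by apply/esym/eqP/negPn/negP => /pd.
Qed.

Lemma hcomp_sum (I : finType) (P : pred I) d (F : I -> S) :
  hcomp d (\sum_(i | P i) F i) = \sum_(i | P i) hcomp d (F i).
Proof.
apply/mpolyP => m.
have mcoeff_sum G : (\sum_(i | P i) G i : S)@_m = \sum_(i | P i) (G i)@_m.
  exact: raddf_sum.
rewrite mcoeff_hcomp !mcoeff_sum; case: ifP => md.
  by apply: eq_bigr => i _; rewrite mcoeff_hcomp md.
by rewrite big1 // => i _; rewrite mcoeff_hcomp md.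
Qed.

Lemma hcompM d e f g : in_deg e g -> hcomp d (f * g) = hcomp (d - e) f * g.
Proof.
move=> qe; apply/mpolyP => m; rewrite mcoeff_hcomp !mcoeffM.
case: ifP => md; last apply/esym.
  apply: eq_bigr => k /eqP defm; rewrite mcoeff_hcomp.
  have [->|/qe q2] := eqVneq g@_k.2 0; first by rewrite !mulr0.
  have := congr1 (fun m' => (mdeg m')%:Z) defm.
  by rewrite mdegD PoszD q2 (eqP md) => ->; rewrite addrK eqxx.
apply: big1 => k /eqP defm; rewrite mcoeff_hcomp.
have [->|/qe q2] := eqVneq g@_k.2 0; first by rewrite mulr0.
case: eqP => [k1|_]; last by rewrite mul0r.
have := congr1 (fun m' => (mdeg m')%:Z) defm.
by rewrite mdegD PoszD q2 k1 subrK => /eqP; rewrite md.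
Qed.

Lemma in_deg_koszul v T : in_deg 1 (ksign S v T * 'X_v).
Proof.
move=> m; rewrite mcoeff_signM mcoeffX.
by case: (U_(v)%MM =P m) => [<- _|_]; rewrite ?mdeg1 // mulr0 eqxx.
Qed.

(** * Chains with values in a free module *)

Definition kdiffv r (c : {set 'I_n} -> 'rV[S]_r) T : 'rV[S]_r :=
  \row_b kdiff X (fun T' => c T' 0 b) T.

Definition concentrated r p (c : {set 'I_n} -> 'rV[S]_r) : Prop :=
  forall T, #|T| != p -> c T = 0.

Section FreeModules.
Variable r : nat.
Implicit Types c : {set 'I_n} -> 'rV[S]_r.

Lemma eq_kdiffv c c' T : c =1 c' -> kdiffv c T = kdiffv c' T.
Proof.
move=> cc'; apply/rowP => b; rewrite !mxE.
by apply: eq_kdiff => T'; rewrite cc'.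
Qed.

Lemma kdiffv_kdiffv c T : kdiffv (kdiffv c) T = 0.
Proof.
apply/rowP => b; rewrite !mxE -[RHS](kdiff_kdiff X (fun T => c T 0 b) T).
by apply: eq_kdiff => T'; rewrite mxE.
Qed.

Lemma kdiffvB c c' T : kdiffv (fun T' => c T' - c' T') T = kdiffv c T - kdiffv c' T.
Proof.
apply/rowP => b; rewrite !mxE -kdiffB.
by apply: eq_kdiff => T'; rewrite !mxE.
Qed.

Lemma kdiffv_mulmx s (A : 'M[S]_(r, s)) c T :
  kdiffv (fun T' => c T' *m A) T = kdiffv c T *m A.
Proof.
apply/rowP => b; rewrite !mxE.
rewrite (eq_bigr (fun i => kdiff X (fun T' => c T' 0 i) T * A i b)); last first.
  by move=> i _; rewrite mxE.
by rewrite -kdiff_sumr; apply: eq_kdiff => T'; rewrite mxE.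
Qed.

Lemma kdiffv_concentrated p c : concentrated p.+1 c -> concentrated p (kdiffv c).
Proof.
move=> cp T cT; apply/rowP => b; rewrite !mxE /kdiff big1 // => v vT.
by rewrite cp ?mxE ?mulr0 // cardsU1 vT.
Qed.

Lemma kdiffv0_concentrated c T : concentrated 0 c -> kdiffv c T = 0.
Proof.
move=> c0; apply/rowP => b; rewrite !mxE /kdiff big1 // => v vT.
by rewrite c0 ?mxE ?mulr0 // cardsU1 vT.
Qed.

Lemma kdiffv_const c T b : (kdiffv c T 0 b)@_0 = 0.
Proof.
rewrite mxE raddf_sum big1 //= => v _.
by rewrite -mulrA mcoeff_signM mcoeffXM mnm0E mulr0.
Qed.

Lemma koszul_free_exact p c : concentrated p c ->
    (forall T, kdiffv c T = 0) -> (forall b, (c set0 0 b)@_0 = 0) ->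
  exists2 w : {set 'I_n} -> 'rV[S]_r,
    concentrated p.+1 w & forall T, kdiffv w T = c T.
Proof.
move=> cp dc c0.
have /fin_all_exists[w wP] (b : 'I_r) : exists w : {set 'I_n} -> S,
    chain_in predT p.+1 w /\ forall T, kdiff X w T = c T 0 b.
  have [||//|w ? ?] := @koszul_exact _ _ p (fun T => c T 0 b); last by exists w.
    by move=> T cT; apply: contraNT cT => /cp->; rewrite mxE.
  by move=> T; have /rowP/(_ b) := dc T; rewrite !mxE.
exists (fun T => \row_b w b T) => T.
  move=> cT; apply/rowP => b; rewrite !mxE; apply: contraNeq cT.
  by case/(proj1 (wP b))/andP.
apply/rowP => b; rewrite mxE -(proj2 (wP b)).
by apply: eq_kdiff => T'; rewrite mxE.
Qed.

(** * Homogeneous chains *)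

Variable sh : 'I_r -> int.

Definition homogeneous j c : Prop :=
  forall T b, in_deg (j - #|T|%:Z - sh b) (c T 0 b).

Definition hpart j c T : 'rV[S]_r := \row_b hcomp (j - #|T|%:Z - sh b) (c T 0 b).

Lemma homog_hpart j c : homogeneous j (hpart j c).
Proof. by move=> T b; rewrite mxE; apply: in_deg_hcomp. Qed.

Lemma hpart_id j c T : homogeneous j c -> hpart j c T = c T.
Proof. by move=> cj; apply/rowP => b; rewrite mxE hcomp_id. Qed.

Lemma eq_hpart j c c' T : c T = c' T -> hpart j c T = hpart j c' T.
Proof. by move=> cc'; apply/rowP => b; rewrite !mxE cc'. Qed.

Lemma hpart_concentrated p j c : concentrated p c -> concentrated p (hpart j c).
Proof.
move=> cp T /cp cT; apply/rowP => b; rewrite !mxE cT mxE.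
by apply: hcomp_id => m; rewrite mcoeff0 eqxx.
Qed.

Lemma hpart_kdiffv j c T : hpart j (kdiffv c) T = kdiffv (hpart j c) T.
Proof.
apply/rowP => b; rewrite !mxE hcomp_sum; apply: eq_bigr => v vT.
rewrite mulrC (hcompM _ _ (@in_deg_koszul v T)) mulrC mxE cardsU1 vT add1n intS.
by congr (_ * hcomp _ _); ring.
Qed.

End FreeModules.

Lemma hpart_mulmx r s (shr : 'I_r -> int) (shs : 'I_s -> int) (A : 'M[S]_(r, s))
    j c T :
  (forall a b, in_deg (shr a - shs b) (A a b)) ->
  hpart shs j (fun T' => c T' *m A) T = hpart shr j c T *m A.
Proof.
move=> gA; apply/rowP => b; rewrite !mxE hcomp_sum; apply: eq_bigr => a _.
by rewrite (hcompM _ _ (@gA a b)) mxE; congr (hcomp _ _ * _); ring.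
Qed.

(** * Dimension shifting along an exact sequence of free modules *)

Section DimensionShift.
Variables (rk : nat -> nat) (sh : forall i, 'I_(rk i) -> int)
  (D : forall i, 'M[S]_(rk i.+1, rk i)).
Hypothesis D_graded : forall i a b, in_deg (sh a - sh b) (D i a b).
Hypothesis D_exact : forall i (v : 'rV_(rk i.+1)),
  v *m D i = 0 <-> exists w : 'rV_(rk i.+2), v = w *m D i.+1.
Hypothesis D_min : forall i a b, (D i.+1 a b)@_0 = 0.

(** Vanishing of the Koszul homology of the image of [D i] in homological
    degree [p] and internal degree [j].  Elements of the image are represented by
    preimages under [D i], so that no submodule occurs in the definition. *)
Definition image_exact i p j : Prop :=
  forall x : {set 'I_n} -> 'rV_(rk i.+1),
  concentrated p x -> homogeneous (@sh i.+1) j x ->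
  (forall T, kdiffv x T *m D i = 0) ->
  exists2 y : {set 'I_n} -> 'rV_(rk i.+1),
    concentrated p.+1 y & forall T, kdiffv y T *m D i = x T *m D i.

Lemma D_complex i : D i.+1 *m D i = 0.
Proof.
apply/row_matrixP => a; rewrite row0 row_mul rowE.
by apply/D_exact; exists (delta_mx 0 a).
Qed.

Lemma mulmx_const i (w : 'rV_(rk i.+2)) b : ((w *m D i.+1) 0 b)@_0 = 0.
Proof.
rewrite mxE raddf_sum big1 //= => a _.
by rewrite rmorphM /= D_min mulr0.
Qed.

Lemma lift_exact i p (c : {set 'I_n} -> 'rV_(rk i.+1)) :
  concentrated p c -> (forall T, c T *m D i = 0) ->
  exists2 w : {set 'I_n} -> 'rV_(rk i.+2),
    concentrated p w & forall T, c T = w T *m D i.+1.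
Proof.
move=> cp cD.
have /fin_all_exists[w wP] T : exists w : 'rV_(rk i.+2),
    c T = w *m D i.+1 /\ (#|T| != p -> w = 0).
  have [_|Tp] := eqVneq #|T| p.
    by have /D_exact[w ->] := cD T; exists w.
  by exists 0; rewrite mul0mx cp.
by exists w => T; have [] := wP T.
Qed.

(** Connecting homomorphisms of 0 -> im D_(i+1) -> F -> im D_i -> 0, with F
    free.  The homology of F vanishes in positive degrees, and minimality makes
    the map induced on homology in degree 0 by the inclusion of im D_(i+1) zero,
    so that [p] = 0 is no exception. *)
Lemma image_exact_shift i p j : image_exact i p.+1 j <-> image_exact i.+1 p j.
Proof.
split=> [ex_i x xp xj dxD|ex_i1 x xp xj dxD].
  (* [x *m D i.+1] bounds in the free module, for [p] = 0 by minimality. *)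
  have [||b|w w_p dw] := @koszul_free_exact _ p (fun T => x T *m D i.+1).
  - by move=> T /xp->; rewrite mul0mx.
  - by move=> T; rewrite kdiffv_mulmx.
  - exact: mulmx_const.
  pose h := hpart (@sh i.+1) j w.
  have dh T : kdiffv h T = x T *m D i.+1.
    rewrite -hpart_kdiffv.
    rewrite (eq_hpart (c' := fun T' => x T' *m D i.+1) _ _ (dw T)).
    by rewrite (hpart_mulmx _ _ _ (@D_graded i.+1)) hpart_id.
  have [||T|y yp dy] := ex_i h; first exact: hpart_concentrated.
  - exact: homog_hpart.
  - by rewrite dh -mulmxA D_complex mulmx0.
  have [||u up eu] := @lift_exact i p.+1 (fun T => h T - kdiffv y T).
  - move=> T Tp; rewrite (kdiffv_concentrated yp) // subr0.
    exact: (hpart_concentrated _ _ w_p).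
  - by move=> T; rewrite mulmxBl dy subrr.
  exists u => // T; rewrite -kdiffv_mulmx -dh -(eq_kdiffv _ eu) kdiffvB.
  by rewrite kdiffv_kdiffv subr0.
have [w0 w0p ew0] := lift_exact (kdiffv_concentrated xp) dxD.
pose w := hpart (@sh i.+2) j w0.
have ew T : w T *m D i.+1 = kdiffv x T.
  rewrite -(hpart_mulmx _ _ _ (@D_graded i.+1)).
  rewrite -(eq_hpart (c' := fun T' => w0 T' *m D i.+1) _ _ (ew0 T)).
  rewrite hpart_kdiffv.
  by apply: eq_kdiffv => T'; rewrite hpart_id.
have [|||y yp ey] := ex_i1 w.
- exact: hpart_concentrated.
- exact: homog_hpart.
- by move=> T; rewrite -kdiffv_mulmx (eq_kdiffv _ ew) kdiffv_kdiffv.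
(* The difference is a cycle of the free module, in positive degree. *)
have [|||u up eu] := @koszul_free_exact _ p.+1 (fun T => x T - y T *m D i.+1).
- by move=> T Tp; rewrite xp // yp // mul0mx subr0.
- by move=> T; rewrite kdiffvB kdiffv_mulmx ey ew subrr.
- by move=> b; rewrite xp ?cards0 // yp ?cards0 // mul0mx subr0 mxE mcoeff0.
exists u => // T.
by rewrite eu mulmxBl -mulmxA D_complex mulmx0 subr0.
Qed.

(** In homological degree 0 the Koszul homology of the image B of [D i] is B
    modulo (x_0, ..., x_(n-1)) B, and minimality makes the images of the basis
    vectors a minimal system of generators of B. *)
Lemma image_exact0 i j :
  image_exact i 0 j <-> forall a : 'I_(rk i.+1), sh a <> j.
Proof.
split=> [ex_i a sha|noj x x0 xj _].
  pose x T : 'rV[S]_(rk i.+1) := if #|T| == 0 then delta_mx 0 a else 0.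
  have x0 : concentrated 0 x by move=> T; rewrite /x => /negPf->.
  have [|T|y _ ey] := ex_i x x0; first move=> T b m.
  - rewrite /x; case: ifP => [/eqP->|_]; last by rewrite mxE mcoeff0 eqxx.
    rewrite mxE eqxx /=; have [->|_] := eqVneq b a; last by rewrite mcoeff0 eqxx.
    rewrite sha subr0 subrr mcoeff1.
    by case: (m =P 0%MM) => [->|_]; rewrite ?mdeg0 ?subr0 ?subrr ?eqxx.
  - by rewrite kdiffv0_concentrated // mul0mx.
  have /D_exact[w /rowP/(_ a)] : (x set0 - kdiffv y set0) *m D i = 0.
    by rewrite mulmxBl ey subrr.
  move/(congr1 (mcoeff 0%MM)); rewrite mulmx_const !mxE raddfB /=.
  have := kdiffv_const y set0 a; rewrite mxE => ->.
  by rewrite /x cards0 eqxx mxE !eqxx mcoeff1 eqxx subr0 => /eqP; rewrite oner_eq0.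
have [T|b|y yp dy] := koszul_free_exact x0; last by exists y => // T; rewrite dy.
- exact: kdiffv0_concentrated.
apply/eqP/negPn/negP => /xj; rewrite mdeg0 cards0 subr0 => /esym/eqP.
by rewrite subr_eq0 => /eqP/esym/noj.
Qed.

(** This is the balancing of Tor, obtained by moving one step at a time from
    the module resolved to its syzygies. *)
Lemma image_exact_basis p j :
  image_exact 0 p j <-> forall a : 'I_(rk p.+1), sh a <> j.
Proof.
rewrite -image_exact0 -[X in _ <-> image_exact X 0 j]add0n.
elim: p 0%N => [|p IHp] i; first by rewrite addn0.
by rewrite image_exact_shift IHp addSnnS.
Qed.

End DimensionShift.
End GradedChains.

(** * Betti numbers of monomial ideals *)

Section MonomialBetti.
Variables (K : fieldType) (n : nat).
Local Notation S := {mpoly K[n]}.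
Local Notation X := (fun v : 'I_n => 'X_v : S).
Variables (I : S -> Prop) (M : pred 'X_{1..n}).
Hypothesis memI : forall f, I f <-> forall m, f@_m != 0 -> M m.
Variable F : free_complex K n.
Hypothesis resF : minimal_free_resolution I F.

(** The resolution is treated together with its augmentation, as one exact
    sequence that ends with the ring itself in position 0. *)
Definition aug_rank (i : nat) : nat := if i is i'.+1 then rank F i' else 1.

Definition aug_shift (i : nat) : 'I_(aug_rank i) -> int :=
  match i with 0 => fun=> 0 | i'.+1 => @shift K n F i' end.

Definition aug_diff (i : nat) : 'M[S]_(aug_rank i.+1, aug_rank i) :=
  match i with 0 => aug F | i'.+1 => diff F i' end.

Lemma in_degree_in_deg d (f : S) : in_degree d f -> in_deg d f.
Proof.
move=> fd m fm; have [|e -> /dhomogP fe] := fd.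
  by apply: contraNneq fm => ->; rewrite mcoeff0.
by rewrite fe // mcoeff_msupp.
Qed.

Lemma aug_diff_graded i (a : 'I_(aug_rank i.+1)) (b : 'I_(aug_rank i)) :
  in_deg (aug_shift a - aug_shift b) (aug_diff i a b).
Proof.
case: i a b => [|i] a b; apply: in_degree_in_deg.
  by rewrite [b]ord1 subr0; apply: aug_graded resF a.
exact: diff_graded resF i a b.
Qed.

Lemma aug_diff_exact i (v : 'rV_(aug_rank i.+1)) :
  v *m aug_diff i = 0 <-> exists w : 'rV_(aug_rank i.+2), v = w *m aug_diff i.+1.
Proof.
case: i v => [|i] v; first exact: exact_aug resF v.
exact: exact_diff resF i v.
Qed.

Lemma aug_diff_minimal i a b : (aug_diff i.+1 a b)@_0 = 0.
Proof. exact: minimal resF i a b. Qed.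

Lemma aug_mulmxP (f : S) :
  (exists v : 'rV_(aug_rank 1), v *m aug_diff 0 = f%:M) <->
  forall m, f@_m != 0 -> M m.
Proof. by rewrite -memI; apply: iff_sym; apply: aug_image resF f. Qed.

Lemma scalar_rV1 (A : 'rV[S]_1) : A = (A 0 0)%:M.
Proof. by apply/rowP => b; rewrite [b]ord1 mxE mulr1n. Qed.

Lemma kdiffv_scalar (c : {set 'I_n} -> S) T :
  kdiffv (fun T' => (c T')%:M : 'rV_1) T = (kdiff X c T)%:M.
Proof.
rewrite [LHS]scalar_rV1 mxE; congr (_%:M).
by apply: eq_kdiff => T'; rewrite mxE mulr1n.
Qed.

Lemma lift_aug p (c : {set 'I_n} -> S) :
  (forall T m, (c T)@_m != 0 -> M m) -> chain_in predT p c ->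
  exists2 x : {set 'I_n} -> 'rV_(aug_rank 1), concentrated p x &
    forall T, x T *m aug_diff 0 = (c T)%:M.
Proof.
move=> cM cp.
have /fin_all_exists[x xP] T : exists x : 'rV_(aug_rank 1),
    x *m aug_diff 0 = (c T)%:M /\ (#|T| != p -> x = 0).
  have [cT0|/cp/eqP cT] := eqVneq (c T) 0.
    by exists 0; rewrite mul0mx cT0 raddf0.
  have [x xT] := proj2 (aug_mulmxP (c T)) (@cM T).
  by exists x; rewrite cT eqxx.
by exists x => T; have [] := xP T.
Qed.

Lemma multipart_monomial (u : {set 'I_n} -> K) (a b : 'X_{1..n}) T :
  (u T != 0 -> (mset T <= a)%MM) ->
  multipart b (fun T' => u T' *: 'X_[a - mset T']) T = if a == b then u T else 0.
Proof.
move=> uTa; have [u0|/uTa leTa] := eqVneq (u T) 0.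
  by rewrite /multipart u0 scale0r mcoeff0 !if_same.
rewrite /multipart mcoeffZ mcoeffX.
case: (a =P b) => [<-|ab]; first by rewrite leTa eqxx mulr1.
case: ifP => // leTb; case: eqP => [eq_ab|_]; last by rewrite mulr0.
by case: ab; rewrite -(submK leTa) eq_ab submK.
Qed.

(** Monomials multiply each basis vector of the exterior algebra by a monomial,
    so the Koszul complex of the ideal is the direct sum of its multigraded
    parts, which are chain complexes over the field. *)
Lemma image_exact_acyclic p j :
  image_exact aug_shift aug_diff 0 p j <->
  forall a : 'X_{1..n}, (mdeg a)%:Z = j -> acyclic K (face M a) p.
Proof.
split=> [ex_p a aj u uD du|acyc x xp xj dxD].
  pose z T : S := u T *: 'X_[a - mset T].
  have uTa T : u T != 0 -> (mset T <= a)%MM by case/uD/andP => /andP[].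
  have zM T m : (z T)@_m != 0 -> M m.
    rewrite mcoeffZ mcoeffX; case: (_ =P m) => [<-|_]; last by rewrite mulr0 eqxx.
    by rewrite mulr1 => /uD/andP[/andP[]].
  have zp : chain_in predT p z.
    move=> T zT; suff /uD/andP[_ ->]: u T != 0 by [].
    by apply: contraNneq zT => uT0; rewrite /z uT0 scale0r.
  have dz T : kdiff X z T = 0.
    apply: multipart_inj => b; rewrite multipart_kdiff.
    rewrite (eq_kdiff _ _ (fun T' => multipart_monomial b (@uTa T'))).
    have -> : multipart b (fun=> 0 : S) T = 0 by rewrite /multipart mcoeff0 if_same.
    by case: eqP => _; rewrite // /kdiff big1 // => v _; rewrite mulr0.
  have zj : homogeneous (@aug_shift 0) j (fun T => (z T)%:M).
    move=> T b m; rewrite [b]ord1 mxE mulr1n mcoeffZ mcoeffX.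
    case: (_ =P m) => [<-|_]; last by rewrite mulr0 eqxx.
    rewrite mulr1 => /uTa leTa; rewrite /= subr0 -aj -mdeg_mset.
    by rewrite -[in RHS](submK leTa) mdegD PoszD addrK.
  have [x0 x0p ex0] := lift_aug zM zp.
  (* The lift is only homogeneous after projection to degree [j]. *)
  pose x := hpart (@aug_shift 1) j x0.
  have ex T : x T *m aug_diff 0 = (z T)%:M.
    rewrite -(hpart_mulmx _ _ _ (@aug_diff_graded 0)).
    rewrite (eq_hpart (c' := fun T' => (z T')%:M : 'rV_1) _ _ (ex0 T)).
    by rewrite hpart_id.
  have [||T|y yp ey] := ex_p x.
  - exact: hpart_concentrated.
  - exact: homog_hpart.
  - by rewrite -kdiffv_mulmx (eq_kdiffv _ ex) kdiffv_scalar dz raddf0.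
  pose w T : S := (y T *m aug_diff 0) 0 0.
  have dw T : kdiff X w T = z T.
    by have /rowP/(_ 0) := ey T; rewrite ex -kdiffv_mulmx !mxE mulr1n => <-.
  exists (multipart a w) => [|T]; last first.
    rewrite -multipart_kdiff /multipart dw -/(multipart a z T).
    by rewrite (multipart_monomial a (@uTa T)) eqxx.
  apply: (@chain_multipart K n M p.+1 a w) => [T|T wT].
    by apply/aug_mulmxP; exists (y T); apply: scalar_rV1.
  by apply: contraNT wT => /= /yp y0; rewrite /w y0 mul0mx mxE.
pose z T : S := (x T *m aug_diff 0) 0 0.
have zE T : (z T)%:M = x T *m aug_diff 0 by rewrite /z -scalar_rV1.
have dz T : kdiff X z T = 0.
  by have /rowP/(_ 0) := dxD T; rewrite -kdiffv_mulmx !mxE => <-.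
have zM T m : (z T)@_m != 0 -> M m.
  by move: m; apply/aug_mulmxP; exists (x T); rewrite zE.
have zp : chain_in predT p z.
  by move=> T zT; apply: contraNT zT => /= /xp x0; rewrite /z x0 mul0mx mxE.
have zj (T : {set _}) : in_deg (j - #|T|%:Z) (z T).
  have := @homog_hpart _ _ _ (@aug_shift 0) j (fun T => x T *m aug_diff 0) T 0.
  rewrite (hpart_mulmx _ _ _ (@aug_diff_graded 0)) hpart_id //.
  by rewrite /= subr0.
have [a|w [wM wp dw]] := @koszul_boundary _ _ M p z; last first.
  have [y yp ey] := lift_aug wM wp; exists y => // T.
  by rewrite -kdiffv_mulmx (eq_kdiffv _ ey) kdiffv_scalar dw zE.
have [aj|/eqP aj] := eqVneq (mdeg a)%:Z j.
  apply: acyc => // [|T]; first exact: chain_multipart.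
  by rewrite -multipart_kdiff /multipart dz mcoeff0 if_same.
exists (fun=> 0) => [T|T]; first by rewrite eqxx.
rewrite /kdiff big1 => [|v _]; last by rewrite mulr0.
rewrite /multipart; case: ifPn => // leTa; apply/esym/eqP/negPn/negP => /zj.
move=> degT; case: aj; rewrite -(submK leTa) mdegD PoszD degT mdeg_mset.
by rewrite subrK.
Qed.

(** The multigraded Betti numbers of a monomial ideal are the dimensions of the
    reduced homology of its upper Koszul complexes; only their vanishing is
    recorded. *)
Lemma betti_eq0P i j :
  betti F i j = 0%N <->
  forall a : 'X_{1..n}, (mdeg a)%:Z = j -> acyclic K (face M a) i.
Proof.
rewrite -image_exact_acyclic.
rewrite (image_exact_basis aug_diff_graded aug_diff_exact aug_diff_minimal).
split=> [/eqP|noj]; last first.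
  apply/eqP; rewrite cards_eq0; apply/eqP/setP => a.
  by rewrite !inE; apply/eqP/noj.
rewrite cards_eq0 => /eqP/setP b0 a /eqP aj.
by have := b0 a; rewrite !inE aj.
Qed.

End MonomialBetti.

(** * Monomials in symbolic powers of cover ideals *)

Section CoverIdeals.
Variables (K : fieldType) (n : nat).
Local Notation S := {mpoly K[n]}.
Implicit Types (P : S -> Prop) (f g : S) (m : 'X_{1..n}).
Implicit Types (R : rel 'I_n) (i j : 'I_n).

Lemma ideal_gen_monomials P f :
  (forall m, f@_m != 0 -> exists c g, P g /\ 'X_[m] = c * g) -> ideal_gen P f.
Proof.
move=> fP; pose s := in_tuple (msupp f).
have /fin_all_exists[c /fin_all_exists[g cgP]] (l : 'I_(size (msupp f))) :
    exists c g, P g /\ 'X_[tnth s l] = c * g.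
  by apply: fP; rewrite -mcoeff_msupp; apply: mem_tnth.
exists (size (msupp f)), (fun l => (f@_(tnth s l))%:MP * c l), g.
split=> [l|]; first by have [] := cgP l.
rewrite [LHS]mpolyE (big_tnth _ _ (msupp f)); apply: eq_bigr => l _.
by rewrite -mulrA -(proj2 (cgP l)) mul_mpolyC.
Qed.

Section Edge.
Variables i j : 'I_n.
Hypothesis ij : i != j.

Definition order_ge (k : nat) f : Prop :=
  forall m, f@_m != 0 -> (k <= m i + m j)%N.

Lemma order_geM k l f g : order_ge k f -> order_ge l g -> order_ge (k + l) (f * g).
Proof.
move=> fk gl m; rewrite -mcoeff_msupp => /msuppM_le.
case/allpairsP => -[m1 m2] /= [m1f m2g ->].
rewrite !mcoeff_msupp in m1f m2g.
by rewrite !mnmDE addnACA leq_add ?fk ?gl.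
Qed.

Lemma order_ge_gen P k f :
  (forall g, P g -> order_ge k g) -> ideal_gen P f -> order_ge k f.
Proof.
move=> Pk [l [c [g [gP ->]]]] m; rewrite raddf_sum /=.
apply: contraNT => kP; rewrite big1 // => a _.
apply/eqP; apply: contraNT kP; apply: (@order_geM 0 k) => //.
exact/Pk/gP.
Qed.

Lemma mem_edge_ideal f : edge_ideal i j f <-> order_ge 1 f.
Proof.
split=> [|f1].
  apply: order_ge_gen => g [->|->] m; rewrite mcoeffX;
    case: (_ =P m) => [<- _|_]; rewrite ?eqxx // !mnm1E eqxx ?addn1 ?add1n //.
apply: ideal_gen_monomials => m /f1; rewrite addn_gt0.
have monE v : (0 < m v)%N -> 'X_[m] = 'X_[m - U_(v)] * 'X_v :> S.
  move=> mv; rewrite -mpolyXD submK //; apply/mnm_lepP => u.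
  by rewrite mnm1E; case: eqP => // <-.
case/orP => /monE->; first by exists 'X_[m - U_(i)], 'X_i; split; first left.
by exists 'X_[m - U_(j)], 'X_j; split; first right.
Qed.

Lemma mem_edge_pow k f : ideal_pow (edge_ideal i j) k f <-> order_ge k f.
Proof.
elim: k f => [|k IHk] f; first by split.
split=> [|fk].
  apply: order_ge_gen => _ [g [h [/mem_edge_ideal g1 /IHk hk ->]]].
  exact: (order_geM g1 hk).
apply: ideal_gen_monomials => m /fk mk.
exists 1, 'X_[m]; split; last by rewrite mul1r.
have [v vij mv] : exists2 v, v = i \/ v = j & (0 < m v)%N.
  have : (0 < m i + m j)%N by apply: leq_trans mk.
  by rewrite addn_gt0 => /orP[]; [exists i; [left|] | exists j; [right|]].
exists 'X_v, 'X_[m - U_(v)]; split; last 1 first.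
- rewrite -mpolyXD addmC submK //; apply/mnm_lepP => u.
  by rewrite mnm1E; case: eqP => // <-.
- apply/mem_edge_ideal => m'; rewrite mcoeffX.
  case: (_ =P m') => [<- _|_]; last by rewrite eqxx.
  by rewrite !mnm1E; case: vij => ->; rewrite eqxx ?addn1.
apply/IHk => m'; rewrite mcoeffX.
case: (_ =P m') => [<- _|_]; last by rewrite eqxx.
rewrite !mnmBE !mnm1E; move: mv mk; case: vij => -> mv mk; rewrite eqxx.
  by rewrite (negPf ij) subn0 -ltnS -addSn subn1 prednK.
by rewrite eq_sym (negPf ij) subn0 -ltnS -addnS subn1 prednK.
Qed.

End Edge.

Definition cover_monomial R (k : nat) : pred 'X_{1..n} :=
  fun m => [forall i, forall j, R i j ==> (k <= m i + m j)%N].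

Lemma cover_monomialP R k m :
  reflect (forall i j, R i j -> (k <= m i + m j)%N) (cover_monomial R k m).
Proof.
apply: (iffP forallP) => [mk i j|mk i]; first by have /forallP/(_ j)/implyP := mk i.
by apply/forallP => j; apply/implyP/mk.
Qed.

Lemma irreflexive_neq R i j : irreflexive R -> R i j -> i != j.
Proof. by move=> Rirr; apply: contraTneq => ->; rewrite Rirr. Qed.

Lemma mem_symbolic_power R k f : irreflexive R ->
  symbolic_power_cover_ideal K R k f <->
  forall m, f@_m != 0 -> cover_monomial R k m.
Proof.
move=> Rirr; split=> [fk m fm|fk i j Rij].
  apply/cover_monomialP => i j Rij.
  by have /mem_edge_pow := fk i j Rij; apply=> //; apply: irreflexive_neq Rij.
apply/mem_edge_pow; first exact: irreflexive_neq Rij.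
by move=> m /fk/cover_monomialP; apply.
Qed.

Lemma mem_cover_ideal R f :
  cover_ideal K R f <-> forall m, f@_m != 0 -> cover_monomial R 1 m.
Proof.
split=> [f1 m fm|f1 i j Rij].
  by apply/cover_monomialP => i j /f1/mem_edge_ideal; apply.
by apply/mem_edge_ideal => m /f1/cover_monomialP; apply.
Qed.

End CoverIdeals.

(** * The bound by gamma *)

Section Gamma.
Variables (n : nat) (G : rel 'I_n).
Hypothesis G_sym : ssrbool.symmetric G.
Implicit Types (A B C U : {set 'I_n}) (u v x : 'I_n).

Lemma independentP A :
  reflect (forall u v, u \in A -> v \in A -> ~~ G u v) (independent G A).
Proof.
apply: (iffP forall_inP) => [iA u v /iA/forall_inP|iA u uA]; first by apply.
by apply/forall_inP => v; apply: iA.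
Qed.

Lemma nbrP A v : reflect (exists2 u, u \in A & G u v) (v \in nbr G A).
Proof. by rewrite inE; apply: exists_inP. Qed.

Lemma component_id U x : x \in component G U x.
Proof. by rewrite inE connect0. Qed.

Lemma component_sub U x : x \in U -> component G U x \subset U.
Proof.
move=> xU; apply/subsetP => y; rewrite inE => /connectP[p].
elim/last_ind: p => [_ -> //|p z _]; rewrite rcons_path last_rcons.
by case/andP=> _ /and3P[_ zU _] ->.
Qed.

Lemma component_closed U x u v :
  x \in U -> u \in component G U x -> v \in U -> G u v -> v \in component G U x.
Proof.
move=> xU uC vU Guv; have /subsetP/(_ u uC) uU := component_sub xU.
move: uC; rewrite !inE => /connect_trans; apply; apply: connect1.
by rewrite /= uU vU.
Qed.

Definition no_isolated A : Prop :=
  forall v, v \notin closed_nbr G A -> exists2 u, u \notin closed_nbr G A & G v u.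

Lemma notin_closed_nbr A v :
  (v \notin closed_nbr G A) = (v \notin nbr G A) && (v \notin A).
Proof. by rewrite in_setU negb_or. Qed.

Lemma bipartition C : bipartite_on G C -> exists X Y : {set 'I_n},
  [/\ X :|: Y = C, [disjoint X & Y],
      forall u v, u \in X -> v \in C -> G u v -> v \in Y,
      forall u v, u \in Y -> v \in C -> G u v -> v \in X & (#|X| <= #|Y|)%N].
Proof.
case/existsP => B bipB.
have bip u v : u \in C -> v \in C -> G u v -> (u \in B) != (v \in B).
  by move=> uC vC; have /forall_inP/(_ _ uC)/forall_inP/(_ _ vC)/implyP := bipB.
have crossI u v : u \in C :&: B -> v \in C -> G u v -> v \in C :\: B.
  rewrite in_setI in_setD => /andP[uC uB] vC /(bip _ _ uC vC).
  by rewrite uB vC andbT; case: (v \in B).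
have crossD u v : u \in C :\: B -> v \in C -> G u v -> v \in C :&: B.
  rewrite in_setI in_setD => /andP[uB uC] vC /(bip _ _ uC vC).
  by rewrite (negPf uB) vC; case: (v \in B).
have dB : [disjoint C :&: B & C :\: B].
  rewrite -setI_eq0; apply/eqP/setP => v; rewrite !inE.
  by case: (v \in B); rewrite ?andbF.
have [leI|ltD] := leqP #|C :&: B| #|C :\: B|.
  by exists (C :&: B), (C :\: B); rewrite setID.
exists (C :\: B), (C :&: B); rewrite setUC setID disjoint_sym; split=> //.
exact: ltnW.
Qed.

(** Absorbing into [A] the smaller side of a bipartite component puts the other
    side into the neighbourhood, because both sides dominate each other in the
    absence of isolated vertices. *)
Lemma admissible_extension A : independent G A -> no_isolated A ->
  exists2 A', independent G A' && no_bipartite_component G (~: closed_nbr G A')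
            & (#|nbr G A| + #|A'| <= #|nbr G A'| + #|A|)%N.
Proof.
have [k] := ubnP #|~: closed_nbr G A|; elim: k A => // k IHk A leU iA isoA.
have [nbA|/forall_inPn[x xU]] :=
  boolP (no_bipartite_component G (~: closed_nbr G A)).
  by exists A => //; rewrite iA.
rewrite negbK => /bipartition[X [Y [defC dXY crossX crossY leXY]]].
have CU := component_sub xU; have Cclosed := component_closed xU.
have xC := component_id (~: closed_nbr G A) x.
move: (component G _ x) => C in defC crossX crossY CU Cclosed xC.
have XC u : u \in X -> u \in C by move=> uX; rewrite -defC in_setU uX.
have YC u : u \in Y -> u \in C by move=> uY; rewrite -defC in_setU uY orbT.
have inU u : u \in C -> u \notin closed_nbr G A.
  by move/(subsetP CU); rewrite in_setC.
have nbrC u : u \in C -> exists2 v, v \in C & G u v.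
  move=> uC; have [v vU Guv] := isoA u (inU u uC).
  by exists v => //; apply: Cclosed uC _ Guv; rewrite in_setC.
have nbrU : nbr G (A :|: X) = nbr G A :|: Y.
  apply/setP => v; rewrite in_setU; apply/nbrP/orP.
    case=> u; rewrite in_setU => /orP[uA|uX] Guv.
      by left; apply/nbrP; exists u.
    have [|vN] := boolP (v \in nbr G A); [by left | right].
    apply: (crossX u) => //; apply: Cclosed (XC _ uX) _ (Guv).
    rewrite in_setC notin_closed_nbr vN /=; apply/negP => vA.
    have := inU _ (XC _ uX); rewrite notin_closed_nbr => /andP[/nbrP[]].
    by exists v; rewrite 1?G_sym.
  case=> [/nbrP[u uA Guv]|vY]; first by exists u; rewrite // in_setU uA.
  have [u uC Gvu] := nbrC v (YC _ vY).
  by exists u; rewrite 1?G_sym // in_setU (crossY v) ?orbT.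
have closedU : closed_nbr G (A :|: X) = closed_nbr G A :|: C.
  by rewrite /closed_nbr nbrU -defC setUACA [Y :|: X]setUC.
have dA u : u \in C -> (u \in A = false) * (u \in nbr G A = false).
  by move/inU; rewrite notin_closed_nbr => /andP[/negPf-> /negPf->].
have iAX : independent G (A :|: X).
  apply/independentP => u v; rewrite !in_setU => /orP[uA|uX] /orP[vA|vX].
  - by have /independentP := iA; apply.
  - by apply: contraFN (dA v (XC v vX)).2 => Guv; apply/nbrP; exists u.
  - apply: contraFN (dA u (XC u uX)).2 => Guv; apply/nbrP; exists v => //.
    by rewrite G_sym.
  by apply/negP => /(crossX _ _ uX (XC v vX)); rewrite (disjointFr dXY).
have isoAX : no_isolated (A :|: X).
  move=> v; rewrite closedU in_setU negb_or => /andP[vU vC].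
  have [u uU Gvu] := isoA v vU; exists u => //.
  rewrite in_setU negb_or uU; apply: contra vC => uC.
  by apply: Cclosed uC _ _; rewrite ?in_setC // G_sym.
have [|A' A'ok leA'] := IHk (A :|: X) _ iAX isoAX.
  rewrite -ltnS; apply: leq_trans leU; rewrite ltnS; apply: proper_card.
  rewrite closedU setCU properEneq subsetIl andbT; apply/eqP => /setP/(_ x).
  by rewrite in_setI xU in_setC xC.
exists A' => //; move: leA'; rewrite nbrU !cardsU.
have -> : nbr G A :&: Y = set0.
  apply/setP => v; rewrite !(in_setI, in_set0).
  by apply/andP => -[vN /YC/dA[_]]; rewrite vN.
have -> : A :&: X = set0.
  apply/setP => v; rewrite !(in_setI, in_set0).
  by apply/andP => -[vA /XC/dA[]]; rewrite vA.
by rewrite !cards0; lia.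
Qed.

Lemma sum_threshold m y : (\sum_(t < m) (y < t.+1) = m - y)%N.
Proof.
elim: m => [|m IHm]; first by rewrite big_ord0.
by rewrite big_ord_recr /= IHm; lia.
Qed.

Section Threshold.
Variables (b : 'I_n -> nat) (m : nat).
Hypothesis b_cover : forall u v, G u v -> (m <= b u + b v)%N.
Hypothesis b_tight : forall v, (0 < b v)%N -> exists2 u, G v u & (b v + b u = m)%N.

Definition lower_set (t : nat) : {set 'I_n} := [set v | (2 * b v < t)%N].

(** A vertex with [2 * m - 2 * b v < t] has [b v > 0], and its partner along a
    tight edge falls below the threshold. *)
Lemma nbr_lower_set t : (t <= m)%N ->
  nbr G (lower_set t) = [set v | (2 * m - 2 * b v < t)%N].
Proof.
move=> tm; apply/setP => v; rewrite [in RHS]inE; apply/nbrP/idP.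
  by case=> u; rewrite inE => ut /b_cover; lia.
move=> vt; have [|u Gvu bvu] := @b_tight v; first by lia.
by exists u; rewrite 1?G_sym // inE; lia.
Qed.

Lemma lower_set_gamma t : (0 < t <= m)%N ->
  (n%:R + #|nbr G (lower_set t)|%:R - #|lower_set t|%:R) / 2 <= gamma G.
Proof.
case/andP=> t0 tm; have nbrt := nbr_lower_set tm.
have iA : independent G (lower_set t).
  apply/independentP => u v; rewrite !inE => ut vt.
  by apply/negP => /b_cover; lia.
have [v|A' A'ok leA'] := admissible_extension iA.
  rewrite notin_closed_nbr nbrt !inE => /andP[vN vA].
  have [|u Gvu bvu] := @b_tight v; first by lia.
  by exists u; rewrite // notin_closed_nbr nbrt !inE; lia.
rewrite /gamma; apply: (bigmax_sup A') => //; rewrite ler_pM2r ?invr_gt0 //.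
by move: leA'; rewrite -(ler_nat rat) !natrD; lra.
Qed.

(** Among the thresholds t = 1, ..., m, the number of those with
    [2 * m - 2 * b v < t] minus the number of those with [2 * b v < t] is
    [2 * b v - m]; the bounds at the single thresholds are summed. *)
Lemma sum_le_gamma : (\sum_v b v)%N%:R <= m%:R * gamma G.
Proof.
have count (P : nat -> {set 'I_n}) :
    (\sum_(t < m) #|P t.+1| = \sum_v \sum_(t < m) (v \in P t.+1))%N.
  rewrite exchange_big; apply: eq_bigr => t _ /=.
  by rewrite -sum1_card big_mkcond; apply: eq_bigr => v _; case: ifP.
have sum_b : (2 * \sum_v b v + \sum_(t < m) #|lower_set t.+1|
    = m * n + \sum_(t < m) #|nbr G (lower_set t.+1)|)%N.
  rewrite [X in _ = (_ + X)%N](eq_bigr (fun t : 'I_m =>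
    #|[set v | (2 * m - 2 * b v < t.+1)%N]|)) => [|t _]; last first.
    by rewrite nbr_lower_set.
  rewrite (count lower_set) (count (fun t => [set v | (2 * m - 2 * b v < t)%N])).
  have -> : (m * n = \sum_(v < n) m)%N by rewrite sum_nat_const card_ord mulnC.
  rewrite big_distrr -!big_split.
  apply: eq_bigr => v _ /=.
  under eq_bigr => t _ do rewrite inE.
  under [in RHS]eq_bigr => t _ do rewrite inE.
  rewrite !sum_threshold.
  have [b0|/b_tight[u _]] := posnP (b v); last by lia.
  by rewrite b0; lia.
have : \sum_(t < m)
      (n%:R + #|nbr G (lower_set t.+1)|%:R - #|lower_set t.+1|%:R) / 2
    <= \sum_(t < m) gamma G.
  by apply: ler_sum => t _; apply: lower_set_gamma; rewrite ltn0Sn ltn_ord.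
rewrite sumr_const card_ord -mulr_suml sumrB big_split /= sumr_const card_ord.
rewrite -!natr_sum -[n%:R *+ m]mulr_natr -[gamma G *+ m]mulr_natl.
have /(congr1 (fun k => k%:R : rat)) := sum_b; rewrite !natrD !natrM.
by lra.
Qed.

End Threshold.
End Gamma.

(** * Reducing a multidegree of the symbolic power to a squarefree one *)

Section Reduction.
Variables (K : fieldType) (n : nat) (G : rel 'I_n).
Hypotheses (G_sym : ssrbool.symmetric G) (G_irr : irreflexive G).
Implicit Types (T C : {set 'I_n}) (u v : 'I_n).

Definition tight_rel (b : 'I_n -> nat) (m : nat) : rel 'I_n :=
  fun u v => G u v && (b u + b v == m)%N.

Lemma faceP (R : rel _) k (a : 'X_{1..n}) T :
  reflect ((forall v, ((v \in T) <= a v)%N) /\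
           (forall u v, R u v -> (k <= a u - (u \in T) + (a v - (v \in T)))%N))
          (face (cover_monomial R k) a T).
Proof.
apply: (iffP andP) => -[leTa aT]; split.
- by move=> v; move/mnm_lepP/(_ v): leTa; rewrite mnmE.
- by move=> u v /(cover_monomialP _ _ _ aT); rewrite !mnmBE !mnmE.
- by apply/mnm_lepP => v; rewrite mnmE.
- by apply/cover_monomialP => u v; rewrite !mnmBE !mnmE; apply: aT.
Qed.

Lemma acyclic_no_face (D : pred {set 'I_n}) p : D =1 pred0 -> acyclic K D p.
Proof.
move=> D0 w wD _; have w0 T : w T = 0.
  by apply/eqP/negPn/negP => /wD; rewrite D0.
exists (fun=> 0) => T; first by rewrite eqxx.
by rewrite w0 /kdiff big1 // => v _; rewrite mulr0.
Qed.

(** The complex at [a] does not change when [a] is replaced by the indicator of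
    [C] and [G] by the edges on which [b] is tight.  Maximality of [C] forces
    the faces into [C] and makes [b] tight at the vertices outside [C]; at those
    of [C] tightness comes from the homology, since otherwise the vertex would
    be the apex of a cone. *)
Lemma squarefree_reduction k (a : 'X_{1..n}) p : (0 < k)%N ->
  ~ acyclic K (face (cover_monomial G k) a) p ->
  exists (b : 'I_n -> nat) C,
    [/\ forall v, a v = (b v + (v \in C))%N,
        forall u v, G u v -> (k.-1 <= b u + b v)%N,
        forall v, (0 < b v)%N -> exists2 u, G v u & (b v + b u = k.-1)%N
      & ~ acyclic K (face (cover_monomial (tight_rel b k.-1) 1) (mset C)) p].
Proof.
move=> k0 nacyc.
have a_cover u v : G u v -> (k <= a u + a v)%N.
  move=> Guv; rewrite leqNgt; apply/negP => ltk; case: nacyc.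
  apply: acyclic_no_face => T; apply/negP => /faceP[_ /(_ u v Guv)]; lia.
pose P C := [forall u, (u \in C) ==> (0 < a u)%N]
  && [forall u, forall v, [&& u \in C, v \in C & G u v] ==> (a u + a v != k)%N].
have [C /maxsetP[/andP[/forallP posC /forallP indepC] maxC]] : {C | maxset P C}.
  apply: ex_maxset; exists set0; apply/andP; split; apply/forallP => u.
    by rewrite in_set0.
  by apply/forallP => v; rewrite in_set0.
have {}posC v : v \in C -> (0 < a v)%N by move/implyP: (posC v).
have {}indepC u v : u \in C -> v \in C -> G u v -> (a u + a v != k)%N.
  by move=> uC vC Guv; have /forallP/(_ v)/implyP := indepC u; apply; rewrite uC vC.
have {}maxC v : (0 < a v)%N -> v \notin C ->
    exists u, [/\ u \in C, G v u & (a v + a u = k)%N].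
  move=> av vC; have [/existsP[u /and3P[uC Gvu /eqP avu]]|no_u] :=
    boolP [exists u, [&& u \in C, G v u & (a v + a u == k)%N]].
    by exists u.
  move: no_u; rewrite negb_exists => /forallP no_u.
  have {}no_u u : u \in C -> G v u -> (a v + a u != k)%N.
    by move=> uC Gvu; have := no_u u; rewrite uC Gvu.
  case/negP: vC; rewrite -(maxC (v |: C)) ?setU11 ?subsetUr //.
  apply/andP; split; apply/forallP => u.
    by apply/implyP; rewrite in_setU1 => /orP[/eqP->|/posC].
  apply/forallP => w; apply/implyP; rewrite !in_setU1.
  case/and3P=> /orP[/eqP->|uC] /orP[/eqP->|wC]; first by rewrite G_irr.
  - exact: no_u.
  - by rewrite G_sym addnC; apply: no_u.
  - exact: indepC.
pose b v := (a v - (v \in C))%N.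
have ab v : a v = (b v + (v \in C))%N.
  by rewrite /b subnK //; case: (boolP (v \in C)) => // /posC.
have b_cover u v : G u v -> (k.-1 <= b u + b v)%N.
  move=> Guv; have := a_cover _ _ Guv; have := @indepC u v.
  have := ab u; have := ab v.
  by case: (u \in C); case: (v \in C) => /=; lia.
have eq_face : face (cover_monomial G k) a
    =1 face (cover_monomial (tight_rel b k.-1) 1) (mset C).
  move=> T; apply/faceP/faceP => -[leT aT].
    have TC v : ((v \in T) <= (v \in C))%N.
      case: (boolP (v \in C)) => [_|vC]; first exact: leq_b1.
      rewrite leqNgt lt0b; apply/negP => vT.
      have [|u [uC Gvu avu]] := maxC v _ vC; first by have := leT v; rewrite vT.
      have := aT v u Gvu; rewrite vT; have := leT v; rewrite vT; lia.
    split=> [v|u v /andP[Guv /eqP buv]]; first by rewrite mnmE.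
    have := aT u v Guv; have := TC u; have := TC v; have := ab u; have := ab v.
    by rewrite !mnmE; lia.
  have {}leT v : ((v \in T) <= (v \in C))%N by have := leT v; rewrite mnmE.
  split=> [v|u v Guv]; first by rewrite ab (leq_trans (leT v)) ?leq_addl.
  have := leT u; have := leT v; have := ab u; have := ab v.
  have := b_cover u v Guv; have := aT u v; rewrite /tight_rel Guv !mnmE /=.
  by case: eqP => [_ /(_ isT)|nbuv _]; lia.
have nacycC : ~ acyclic K (face (cover_monomial (tight_rel b k.-1) 1) (mset C)) p.
  by move=> acycC; apply: nacyc; apply: eq_acyclic acycC => T; rewrite eq_face.
exists b, C; split=> // v bv.
have [vC|vC] := boolP (v \in C); last first.
  have [|u [uC Gvu avu]] := maxC v _ vC; first by rewrite ab addn_gt0 bv.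
  exists u => //; move: avu (ab v) (ab u); rewrite uC (negPf vC); lia.
have [/existsP[u /andP[Gvu /eqP buv]]|no_u] :=
  boolP [exists u, tight_rel b k.-1 v u].
  by exists u.
(* No edge of the reduced graph contains [v], so it is the apex of a cone. *)
case: nacycC; apply: (@acyclic_cone _ _ _ _ v) => T.
have tightN u w : tight_rel b k.-1 u w -> (u != v) && (w != v).
  move=> tuw; apply/andP; split; apply: contra no_u => /eqP eqv; apply/existsP.
    by exists w; rewrite -eqv.
  by exists u; move: tuw; rewrite /tight_rel eqv G_sym addnC.
apply/faceP/faceP => -[leT aT]; split=> [u|u w tuw].
- by have := leT u; rewrite in_setU1; case: (u \in T); rewrite ?orbT.
- have := aT u w tuw; have /andP[uv wv] := tightN _ _ tuw.
  by rewrite !in_setU1 (negPf uv) (negPf wv).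
- by have := leT u; rewrite in_setU1 mnmE; case: eqP => [->|]; rewrite ?vC.
have := aT u w tuw; have /andP[uv wv] := tightN _ _ tuw.
by rewrite !in_setU1 (negPf uv) (negPf wv).
Qed.

End Reduction.

(** * Regularity *)

Section Regularity.
Variables (K : fieldType) (n : nat).
Variables (I : {mpoly K[n]} -> Prop) (M : pred 'X_{1..n}) (r : int).
Hypothesis memI : forall f, I f <-> forall m, f@_m != 0 -> M m.
Hypothesis regI : is_regularity I r.

Lemma regularity_attained :
  exists (a : 'X_{1..n}) (p : nat),
    ~ acyclic K (face M a) p /\ r = (mdeg a)%:Z - p%:Z.
Proof.
have [F [resF [p [j [bpj ->]]] _]] := regI.
apply: NNPP => no_a; apply: bpj; apply/(betti_eq0P memI resF) => a aj.
by apply: NNPP => nacyc; apply: no_a; exists a, p; rewrite aj.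
Qed.

Lemma le_regularity (a : 'X_{1..n}) (p : nat) :
  ~ acyclic K (face M a) p -> (mdeg a)%:Z - p%:Z <= r.
Proof.
move=> nacyc; have [F [resF _ maxr]] := regI; apply: maxr => b0.
by apply: nacyc; move/(betti_eq0P memI resF): b0; apply.
Qed.

End Regularity.

Lemma eq_is_regularity (K : fieldType) n (I I' : {mpoly K[n]} -> Prop) r :
  (forall f, I f <-> I' f) -> is_regularity I r -> is_regularity I' r.
Proof.
move=> II' [F [[gA gD imA exA exD minF] bF maxF]]; exists F; split=> //.
by split=> // f; rewrite -II'.
Qed.

Lemma spanning_subgraph_regularity (K : fieldType) n (R : rel 'I_n) r :
  is_regularity
    (cover_ideal K (subgraph_rel ([set: 'I_n], [set e | R e.1 e.2]))) r ->
  is_regularity (cover_ideal K R) r.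
Proof.
rewrite /subgraph_rel /=.
have val_enum (i : 'I_#|[set: 'I_n]|) : val (enum_val i) = val i.
  rewrite /enum_val -(nth_map _ (val i) val) ?size_map -?cardE //.
  have -> : enum [set: 'I_n] = enum 'I_n by apply: eq_enum => u; rewrite inE.
  by rewrite val_enum_ord nth_iota ?add0n // -[n in (_ < n)%N]card_ord -cardsT.
(* Both index types have the same size, and [enum_val] preserves values, so it
   becomes the identity once the sizes are identified. *)
have cardT : #|[set: 'I_n]| = n by rewrite cardsT card_ord.
move: (@enum_val _ _) val_enum; rewrite cardT => ev val_ev.
apply: eq_is_regularity => f; have evE i : ev i = i by apply: val_inj.
split=> Rf i j; first by have := Rf i j; rewrite inE !evE.
by rewrite inE !evE; apply: Rf.
Qed.

(* The default 0 of the maximum is reg J(H) for an edgeless H. *)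
Theorem proposition3p1 (K : fieldType) (n : nat) (G : rel 'I_n)
    (G_sym : ssrbool.symmetric G) (G_irr : irreflexive G)
    (k : nat) (k_ge1 : (1 <= k)%N)
    (regJk : int)
    (regJkP : is_regularity (symbolic_power_cover_ideal K G k) regJk)
    (regJ : {set 'I_n} * {set 'I_n * 'I_n} -> int)
    (regJP : forall H, is_subgraph G H ->
       is_regularity (cover_ideal K (subgraph_rel H)) (regJ H)) :
  regJk%:~R <= (k%:R - 1) * gamma G
               + (\big[Num.max/0]_(H | is_subgraph G H) regJ H)%:~R.
Proof.
have [a [p [nacyc ->]]] :=
  regularity_attained (fun f => mem_symbolic_power k f G_irr) regJkP.
have [b [C [ab b_cover b_tight nacycC]]] :=
  squarefree_reduction G_sym G_irr k_ge1 nacyc.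
set R := tight_rel G b k.-1 in nacycC.
pose H := ([set: 'I_n], [set e : 'I_n * 'I_n | R e.1 e.2]).
have HG : is_subgraph G H.
  apply/forall_inP => -[u v]; rewrite !inE /= => /andP[Guv buv].
  by rewrite /R /tight_rel G_sym Guv addnC buv.
have leC : (mdeg (mset C))%:Z - p%:Z
    <= \big[Num.max/0]_(H | is_subgraph G H) regJ H.
  apply: le_trans (le_bigmax_cond 0 regJ HG).
  apply: le_regularity nacycC; first exact: mem_cover_ideal.
  exact: spanning_subgraph_regularity (regJP H HG).
have leb := sum_le_gamma G_sym b_cover b_tight.
have -> : mdeg a = (\sum_v b v + #|C|)%N.
  rewrite mdegE (eq_bigr _ (fun v _ => ab v)) big_split /=; congr (_ + _)%N.
  by rewrite -sum1_card [RHS]big_mkcond; apply: eq_bigr => v _; case: ifP.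
move: leC leb; rewrite mdeg_mset -(ler_int rat).
have -> : k%:R - 1 = k.-1%:R :> rat.
  by rewrite -[k in LHS](prednK k_ge1) -natr1 addrK.
by rewrite !intrB PoszD intrD -!pmulrn; lra.
Qed.
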